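(* Let $\mu\in\mathbb{R}^n$ satisfy $\mu_1\ge\mu_2\ge\cdots\ge\mu_n$, with blocks $I_1,\dots,I_r$. Let $\{M_m\}_{m\ge1}$ be a sequence of real symmetric $n\times n$ matrices converging to $0$ such that $M_m/\|M_m\|$ converges to $M$. Let $U_m\to U\in O^n$ be a sequence of orthogonal matrices such that $$\mathrm{Diag}\,\mu+M_m=U_m\big(\mathrm{Diag}\,\lambda(\mathrm{Diag}\,\mu+M_m)\big)U_m^T\quad\text{for all } m=1,2,\dots.$$ Then: 1. The orthogonal matrix $U$ is block-diagonal, $U=\mathrm{diag}(V_1,V_2,\dots,V_r)$ (with zero off-diagonal blocks), where $V_l$ is an orthogonal matrix of size $|I_l|\times|I_l|$ for all $l$. 2. $U^TM_{\mathrm{in}}U=\mathrm{Diag}\,h$, where $h=\big(\lambda(X_1^TMX_1)^T,\dots,\lambda(X_r^TMX_r)^T\big)^T$. 3. For any indices $i\in I_l$, $j\in I_s$, and $t\in\{1,\dots,r\}$, as $m\to\infty$, $$\sum_{p\in I_t}U_m^{ip}U_m^{jp}=\delta_{ij}\delta_{lt}+\frac{\delta_{lt}-\delta_{st}}{\mu_i-\mu_j}M^{ij}\|M_m\|+o(\|M_m\|),$$ with the understanding that the fraction is zero whenever $\delta_{lt}=\delta_{st}$, no matter what the denominator is.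
   Context: $O^n$ is the set of real orthogonal $n\times n$ matrices; $\lambda(A)$ is the vector of eigenvalues of the symmetric matrix $A$ in nonincreasing order; $\mathrm{Diag}\,x$ is the diagonal matrix with $x$ on the diagonal; $\|X\|=\sqrt{\mathrm{tr}(XX^T)}$; $\delta$ is the Kronecker delta; matrix entries are written $H^{ij}$. Convergence of $M_m/\|M_m\|$ presupposes $M_m\neq0$. Blocks: $i\sim j$ iff $\mu_i=\mu_j$. Since $\mu$ is nonincreasing, the equivalence classes are consecutive intervals $I_1=\{1,\dots,\iota_1\}$, $I_2=\{\iota_1+1,\dots,\iota_2\}$, ..., $I_r=\{\iota_{r-1}+1,\dots,\iota_r\}$ with $\iota_0=0$, $\iota_r=n$. $X_l=[e^{\iota_{l-1}+1},\dots,e^{\iota_l}]$ is the $n\times|I_l|$ matrix whose columns are the standard basis vectors indexed by $I_l$. For a square matrix $H$: $H_{\mathrm{in}}^{ij}=H^{ij}$ if $i\sim j$ and $0$ otherwise. *)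

(* Defs.v *)
From mathcomp Require Import all_boot all_order all_algebra.
From mathcomp Require Import complex.
From mathcomp Require Import all_classical all_reals all_analysis.

Set Implicit Arguments.
Unset Strict Implicit.
Unset Printing Implicit Defensive.

Import Order.TTheory GRing.Theory Num.Theory.
Import numFieldNormedType.Exports.

Local Open Scope classical_set_scope.
Local Open Scope ring_scope.

Definition orthogonalmx (R : realType) (n : nat) (U : 'M[R]_n) : Prop :=
  U^T *m U = 1%:M.

Definition frobenius (R : realType) (m n : nat) (A : 'M[R]_(m, n)) : R :=
  Num.sqrt (\tr (A *m A^T)).

Definition nonincreasing_rv (R : realType) (n : nat) (v : 'rV[R]_n) : Prop :=
  forall i j : 'I_n, (i <= j)%N -> v 0 j <= v 0 i.

(* [v] lists the roots of the characteristic polynomial of [A], counted with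
   multiplicity, in nonincreasing order. *)
Definition ordered_eigenvalues (R : realType) (n : nat) (A : 'M[R]_n)
    (v : 'rV[R]_n) : Prop :=
  nonincreasing_rv v /\ char_poly A = \prod_(i < n) ('X - (v 0 i)%:P).

(* The default value 0 is only taken when the characteristic polynomial of [A]
   does not split over [R]; by [lambdaP] this never happens for symmetric
   matrices. *)
Definition lambda (R : realType) (n : nat) (A : 'M[R]_n) : 'rV[R]_n :=
  xget 0 [set v | ordered_eigenvalues A v].

Lemma lambdaP (R : realType) (n : nat) (A : 'M[R]_n) :
  A \is symmetricmx -> ordered_eigenvalues A (lambda A).
Proof.
move=> A_sym.
pose f : {rmorphism R -> complex.complex R} := complex.real_complex R.
pose B := map_mx f A; pose P := spectralmx B; pose d := spectral_diag B.
have B_herm : B \is hermsymmx.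
  apply: realsym_hermsym; last first.
    apply/mxOverP => i j; rewrite mxE.
    by apply/complex.complex_realP; exists (A i j).
  apply/is_hermitianmxP; apply/matrixP => i j.
  have /is_hermitianmxP/matrixP/(_ i j) := A_sym.
  by rewrite !mxE !expr0 !mul1r => ->.
have B_eq : B = invmx P *m diag_mx d *m P.
  by apply/orthomx_spectralP; exact: hermitian_normalmx.
have P_unit : P \in unitmx by exact: spectral_unit.
have charB : char_poly B = \prod_(i < n) ('X - (d 0 i)%:P).
  have -> : char_poly B = char_poly (diag_mx d).
    rewrite /char_poly; set PP := map_mx polyC P.
    set QQ := map_mx polyC (invmx P).
    have QP : QQ *m PP = 1%:M by rewrite -map_mxM mulVmx// map_mx1.
    have -> : char_poly_mx B = QQ *m char_poly_mx (diag_mx d) *m PP.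
      rewrite /char_poly_mx mulmxBr mulmxBl B_eq !map_mxM -/PP -/QQ.
      by rewrite mul_mx_scalar -scalemxAl QP scalemx1.
    by rewrite !det_mulmx mulrAC -det_mulmx QP det1 mul1r.
  rewrite char_poly_trig ?diag_mx_is_trig//.
  by apply: eq_bigr => i _; rewrite mxE eqxx mulr1n.
have d_real i : complex.real_complex R (complex.Re (d 0 i)) = d 0 i.
  apply: complex.RRe_real.
  exact: (mxOverP (hermitian_spectral_diag_real B_herm)).
pose r := [seq complex.Re (d 0 i) | i <- enum 'I_n].
have charA : char_poly A = \prod_(x <- r) ('X - x%:P).
  apply: (@map_poly_inj _ _ f); rewrite map_char_poly charB.
  rewrite rmorph_prod big_map big_enum /=; apply: eq_bigr => i _.
  by rewrite rmorphB /= map_polyX map_polyC /= d_real.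
have charA_sort : char_poly A = \prod_(x <- sort >=%R r) ('X - x%:P).
  by rewrite charA; apply: perm_big; rewrite perm_sym perm_sort.
have sz : size (sort >=%R r) = n.
  by rewrite size_sort size_map size_enum_ord.
have : exists v, ordered_eigenvalues A v.
  exists (\row_i (sort >=%R r)`_i); split=> [i j ij|].
    rewrite !mxE.
    have := @sorted_leq_nth _ >=%R (rev_trans le_trans) (@lexx _ _) 0 _
      (sort_sorted (fun x y => le_total y x) r) i j.
    by apply=> //; rewrite inE sz.
  rewrite charA_sort (big_nth 0) big_mkord sz.
  by apply: eq_bigr => i _; rewrite mxE.
exact: xgetPex.
Qed.

(* The distinct values of [mu]; in decreasing order when [mu] is nonincreasing,
   by [block_values_sorted]. *)
Definition block_values (R : realType) (n : nat) (mu : 'rV[R]_n) : seq R :=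
  undup [seq mu 0 i | i <- enum 'I_n].

Definition nblocks (R : realType) (n : nat) (mu : 'rV[R]_n) : nat :=
  size (block_values mu).

Lemma block_values_sorted (R : realType) (n : nat) (mu : 'rV[R]_n) :
  nonincreasing_rv mu -> sorted >%R (block_values mu).
Proof.
move=> mu_dec; have mu_sorted : sorted >=%R [seq mu 0 i | i <- enum 'I_n].
  rewrite sorted_map; apply: (@sub_sorted _ (relpre val leq)).
    by move=> i j; exact: mu_dec.
  by rewrite -sorted_map val_enum_ord iota_sorted.
have : sorted >=%R (block_values mu).
  apply: subseq_sorted mu_sorted; first exact: rev_trans le_trans.
  exact: undup_subseq.
rewrite -(rev_sorted <=%R) -(rev_sorted <%R).
by rewrite lt_sorted_uniq_le rev_uniq undup_uniq.
Qed.

(* Blocks are numbered from 0. *)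
Definition block (R : realType) (n : nat) (mu : 'rV[R]_n)
    (l : 'I_(nblocks mu)) : {set 'I_n} :=
  [set i | mu 0 i == (block_values mu)`_l].

Lemma sum_card_block (R : realType) (n : nat) (mu : 'rV[R]_n) :
  (\sum_(l < nblocks mu) #|block l| = n)%N.
Proof.
under eq_bigr do rewrite -sum1_card.
rewrite (exchange_big_dep xpredT)//= -[RHS]card_ord -sum1_card.
apply: eq_bigr => i _.
have mu_i : mu 0 i \in block_values mu.
  by rewrite mem_undup map_f// mem_enum.
have lt_i : (index (mu 0%R i) (block_values mu) < nblocks mu)%N.
  by rewrite index_mem.
rewrite (big_pred1 (Ordinal lt_i))// => l; rewrite /= inE -val_eqE /=.
apply/eqP/eqP => [->|->]; first by rewrite index_uniq// undup_uniq.
by rewrite nth_index.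
Qed.

(* [enum_val] enumerates the indices of a block in increasing order. *)
Definition block_basis (R : realType) (n : nat) (mu : 'rV[R]_n)
    (l : 'I_(nblocks mu)) : 'M[R]_(n, #|block l|) :=
  \matrix_(i, k) (i == enum_val k)%:R.

Definition mx_in (R : realType) (n : nat) (mu : 'rV[R]_n) (H : 'M[R]_n) :
    'M[R]_n :=
  \matrix_(i, j) (if mu 0 i == mu 0 j then H i j else 0).

Definition block_diag_mx (R : realType) (n : nat) (mu : 'rV[R]_n)
    (V : forall l : 'I_(nblocks mu), 'M[R]_#|block l|) : 'M[R]_n :=
  castmx (sum_card_block mu, sum_card_block mu) (\mxdiag_l V l).

Definition block_row (R : realType) (n : nat) (mu : 'rV[R]_n)
    (v : forall l : 'I_(nblocks mu), 'rV[R]_#|block l|) : 'rV[R]_n :=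
  castmx (erefl, sum_card_block mu) (\mxrow_l v l).

(* Main.v *)
(* The limit of [U_m^T (diag mu + M_m) U_m] is diagonal with nonincreasing
   diagonal, so it equals [diag mu]; hence the eigenvalues converge to [mu] and
   [U] commutes with [diag mu], i.e. it is block-diagonal.  Reading
   [(diag mu + M_m) U_m = U_m diag lambda] entrywise gives the exact first-order
   rate of the off-block entries of [U_m], from which the sums over a block
   follow (by row orthogonality when all three blocks coincide).  Dividing the
   within-block entries of [U_m^T (diag mu + M_m) U_m - diag mu] by [|M_m|], the
   part coming from [diag mu] vanishes in the limit, so [U^T M U] is diagonal
   with nonincreasing diagonal on every block. *)
Require Import Defs.
From mathcomp Require Import all_boot all_order all_algebra.
From mathcomp Require Import all_classical all_reals all_analysis.
From mathcomp Require Import ring.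

Set Implicit Arguments.
Unset Strict Implicit.
Unset Printing Implicit Defensive.

Import Order.TTheory GRing.Theory Num.Theory.
Import numFieldNormedType.Exports.

Local Open Scope classical_set_scope.
Local Open Scope ring_scope.

(** * Uniqueness of ordered eigenvalues and invariance under conjugation *)

(** Unique factorization makes the two lists of roots permutations of each other, and sorted
    permutations are equal. *)
Lemma nonincreasing_rv_inj (R : realType) (n : nat) (v w : 'rV[R]_n) :
  nonincreasing_rv v -> nonincreasing_rv w ->
  \prod_(i < n) ('X - (v 0 i)%:P) = \prod_(i < n) ('X - (w 0 i)%:P) -> v = w.
Proof.
have srt (u : 'rV[R]_n) : nonincreasing_rv u ->
    sorted >=%R [seq u 0 i | i <- enum 'I_n].
  move=> u_dec; rewrite sorted_map; apply: (@sub_sorted _ (relpre val leq)).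
    by move=> i j; exact: u_dec.
  by rewrite -sorted_map val_enum_ord iota_sorted.
have prodE (u : 'rV[R]_n) : \prod_(i < n) ('X - (u 0 i)%:P) =
    \prod_(x <- [seq u 0 i | i <- enum 'I_n]) ('X - x%:P).
  by rewrite big_map big_enum.
move=> v_dec w_dec; rewrite !prodE => /prod_XsubC_eq vw.
have /eq_in_map eq_vw := sorted_eq ge_trans ge_anti (srt _ v_dec) (srt _ w_dec) vw.
by apply/rowP => i; apply: eq_vw; rewrite mem_enum.
Qed.

Lemma lambda_eq (R : realType) (n : nat) (A : 'M[R]_n) (v : 'rV[R]_n) :
  ordered_eigenvalues A v -> lambda A = v.
Proof.
move=> Av; apply: xget_unique => // w [w_dec w_char].
by case: Av => v_dec v_char; apply: nonincreasing_rv_inj; rewrite -?w_char.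
Qed.

Lemma char_poly_conj (R : comNzRingType) (n : nat) (P Q A : 'M[R]_n) :
  Q *m P = 1%:M -> char_poly (Q *m A *m P) = char_poly A.
Proof.
move=> QP1; have QP : map_mx polyC Q *m map_mx polyC P = 1%:M.
  by rewrite -map_mxM QP1 map_mx1.
rewrite /char_poly; have -> : char_poly_mx (Q *m A *m P) =
    map_mx polyC Q *m char_poly_mx A *m map_mx polyC P.
  by rewrite /char_poly_mx mulmxBr mulmxBl !map_mxM mul_mx_scalar -scalemxAl QP
    scalemx1.
by rewrite !det_mulmx mulrAC -det_mulmx QP det1 mul1r.
Qed.

(** The device by which [lambda] is computed, both for [diag_mx mu] and for the compression of [M]
    to each block. *)
Lemma lambda_diag_conj (R : realType) (n : nat) (P A : 'M[R]_n)
    (v : 'rV[R]_n) :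
  orthogonalmx P -> nonincreasing_rv v -> P^T *m A *m P = diag_mx v ->
  lambda A = v.
Proof.
move=> P_orth v_dec Av; apply: lambda_eq; split=> //.
rewrite -(char_poly_conj A P_orth) Av char_poly_trig ?diag_mx_is_trig//.
by apply: eq_bigr => i _; rewrite mxE eqxx mulr1n.
Qed.

Lemma orthogonalmx_trr (R : realType) (n : nat) (P : 'M[R]_n) :
  orthogonalmx P -> P *m P^T = 1%:M.
Proof. exact: mulmx1C. Qed.

(** * Entrywise limits, the norm and little-o *)

Lemma cvg_sumr (R : realType) (I : finType) (P : pred I) (f : I -> nat -> R)
    (a : I -> R) :
  (forall i, P i -> f i m @[m --> \oo] --> a i) ->
  (\sum_(i | P i) f i m) @[m --> \oo] --> \sum_(i | P i) a i.
Proof. by move=> fa; apply: cvg_big => //; exact: add_continuous. Qed.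

Lemma cvg_mulmx_coord (R : realType) (p q r : nat) (A_ : nat -> 'M[R]_(p, q))
    (A : 'M[R]_(p, q)) (B_ : nat -> 'M[R]_(q, r)) (B : 'M[R]_(q, r)) :
  (forall i j, A_ m i j @[m --> \oo] --> A i j) ->
  (forall i j, B_ m i j @[m --> \oo] --> B i j) ->
  forall i j, (A_ m *m B_ m) i j @[m --> \oo] --> (A *m B) i j.
Proof.
move=> AA BB i j; rewrite mxE; under eq_fun do rewrite mxE.
by apply: cvg_sumr => k _; exact: cvgM.
Qed.

Lemma cvg_coord (R : realType) (p q : nat) (A_ : nat -> 'M[R]_(p, q))
    (A : 'M[R]_(p, q)) :
  A_ @ \oo --> A -> forall i j, A_ m i j @[m --> \oo] --> A i j.
Proof.
move=> AA i j.
by apply: (continuous_cvg _ (h := fun B : 'M[R]_(p, q) => B i j)) AA;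
  exact: coord_continuous.
Qed.

Lemma frobenius_eq0 (R : realType) (p q : nat) (A : 'M[R]_(p, q)) :
  (frobenius A == 0) = (A == 0).
Proof.
have tr_ge0 i : 0 <= \sum_j A i j ^+ 2 by apply: sumr_ge0 => j _; exact: sqr_ge0.
have trE : \tr (A *m A^T) = \sum_i \sum_j A i j ^+ 2.
  by apply: eq_bigr => i _; rewrite mxE; apply: eq_bigr => j _; rewrite mxE.
apply/eqP/eqP => [/eqP|->]; last by rewrite /frobenius mul0mx mxtrace0 sqrtr0.
rewrite sqrtr_eq0 trE => le0; apply/matrixP => i j; rewrite mxE.
have /eqP : \sum_i \sum_j A i j ^+ 2 = 0.
  by apply/eqP; rewrite eq_le le0 sumr_ge0.
rewrite psumr_eq0 // => /allP /(_ i); rewrite mem_index_enum => /(_ isT) /eqP.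
move/eqP; rewrite psumr_eq0 => [/allP /(_ j)|k _]; last exact: sqr_ge0.
by rewrite mem_index_enum sqrf_eq0 => /(_ isT) /eqP.
Qed.

(** Division by [nu] turns the little-o claim into an ordinary limit. *)
Lemma eqaddo_ratio (R : realType) (f g nu : nat -> R) :
  (forall m, nu m != 0) -> ((f m - g m) / nu m) @[m --> \oo] --> (0 : R) ->
  f = g +o_\oo nu.
Proof.
move=> nu_neq0 fg0; apply/eqaddoP => e e_gt0.
move/cvgr0Pnorm_le : fg0 => /(_ _ e_gt0); apply: filterS => m /=.
by rewrite normrM normfV ler_pdivrMr ?normr_gt0.
Qed.

(** * Blocks of equal entries and their enumeration *)

Section blocks.
Context {R : realType} {n : nat} (mu : 'rV[R]_n).

Lemma in_block (i : 'I_n) : exists l : 'I_(nblocks mu), i \in block l.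
Proof.
have mu_i : mu 0 i \in block_values mu.
  by rewrite mem_undup map_f// mem_enum.
have lt_i : (index (mu 0%R i) (block_values mu) < nblocks mu)%N.
  by rewrite index_mem.
by exists (Ordinal lt_i); rewrite inE /= nth_index.
Qed.

Lemma block_mu (l : 'I_(nblocks mu)) i j :
  i \in block l -> (j \in block l) = (mu 0 i == mu 0 j).
Proof. by rewrite !inE eq_sym => /eqP ->. Qed.

Lemma block_inj (l s : 'I_(nblocks mu)) i :
  i \in block l -> (i \in block s) = (l == s).
Proof.
by rewrite !inE => /eqP ->; rewrite nth_uniq// ?ltn_ord// undup_uniq.
Qed.

(** Enumerating a set filters the increasing enumeration of ['I_n], so the result stays
    increasing. *)
Lemma enum_block_lt (l : 'I_(nblocks mu)) (a b : 'I_#|block l|) :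
  (a < b)%N -> (enum_val a < enum_val b)%N.
Proof.
move=> ab; have srt : sorted (relpre val ltn) (enum (block l)).
  rewrite {1}/enum_mem sorted_filter//; first by move=> ? ? ?; exact: ltn_trans.
  by rewrite -enumT -sorted_map val_enum_ord iota_ltn_sorted.
(* The two values are read with different defaults; a common one is needed to compare positions in
   the list. *)
rewrite /enum_val (set_nth_default (enum_default b) (enum_default a)) -?cardE//.
have tr : transitive (relpre (val : 'I_n -> nat) ltn).
  by move=> ? ? ?; exact: ltn_trans.
by apply: (sorted_ltn_nth tr _ srt) => //; rewrite inE -cardE.
Qed.

(** Otherwise monotonicity of [mu] would contradict the strict decrease of its distinct values. *)
Lemma block_lt (l s : 'I_(nblocks mu)) i j :
  nonincreasing_rv mu -> (l < s)%N -> i \in block l -> j \in block s ->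
  (i < j)%N.
Proof.
move=> mu_dec ls; rewrite !inE => /eqP il /eqP js.
rewrite ltnNge; apply/negP => /mu_dec; rewrite il js leNgt => /negP; apply.
have gt_tr : transitive (>%R : rel R) by move=> ? ? ? /[swap]; exact: lt_trans.
by apply: (sorted_ltn_nth gt_tr _ (block_values_sorted mu_dec));
  rewrite ?inE.
Qed.

(* Both sides are increasing enumerations of the same total order. *)
Lemma cast_Rank (l : 'I_(nblocks mu)) (k : 'I_#|block l|) :
  nonincreasing_rv mu ->
  cast_ord (sum_card_block mu) (tagnat.Rank _ k) = enum_val k.
Proof.
move=> mu_dec.
pose T := {l : 'I_(nblocks mu) & 'I_#|block l|}.
pose f (p : T) : 'I_n := cast_ord (sum_card_block mu) (tagnat.rank p).
pose g (p : T) : 'I_n := enum_val (tagged p).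
suff fg : f =1 g by exact: (fg (Tagged _ k)).
apply: (Order.mono_unique (T := T)).
- exact: le_total.
- by rewrite tagnat.card card_ord sum_card_block.
- move=> p q; rewrite -(tagnat.le_rank p q); by [].
- apply: le_mono => -[a x] [b y]; rewrite ltEsig/= !ltEord /g /= leEord.
  case: (ltngtP a b) => //= [ab _|/val_inj ab].
    by apply: (block_lt mu_dec ab); exact: enum_valP.
  by case: _ / ab in y *; rewrite tagged_asE; exact: enum_block_lt.
Qed.

Lemma block_enum_val i : exists l, exists k : 'I_#|block (mu := mu) l|,
  i = enum_val k.
Proof.
have [l il] := in_block i.
by exists l, (enum_rank_in il i); rewrite enum_rankK_in.
Qed.

Lemma block_rowE (v : forall l : 'I_(nblocks mu), 'rV[R]_#|block l|) l k :
  nonincreasing_rv mu -> block_row v 0 (enum_val k) = v l 0 k.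
Proof.
move=> mu_dec; rewrite -cast_Rank// /block_row castmxE /= cast_ord_id.
rewrite cast_ordK; have /matrixP/(_ 0 k) := mxrowK v l.
by rewrite mxE.
Qed.

Lemma mulmx_block_basis p (A : 'M[R]_(p, n)) (l : 'I_(nblocks mu)) i k :
  (A *m block_basis l) i k = A i (enum_val k).
Proof.
rewrite mxE (bigD1 (enum_val k))//= mxE eqxx mulr1 big1 ?addr0// => j jk.
by rewrite mxE (negPf jk) mulr0.
Qed.

Lemma tr_block_basis_mulmx p (A : 'M[R]_(n, p)) (l : 'I_(nblocks mu)) i k :
  ((block_basis l)^T *m A) k i = A (enum_val k) i.
Proof.
rewrite mxE (bigD1 (enum_val k))//= !mxE eqxx mul1r big1 ?addr0// => j jk.
by rewrite !mxE (negPf jk) mul0r.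
Qed.

(** By [cast_Rank], position [k] of block [l] sits at index [enum_val k], so equality can be checked
    block by block. *)
Lemma eq_block_diag_mx (V : forall l : 'I_(nblocks mu), 'M[R]_#|block l|)
    (A : 'M[R]_n) :
  nonincreasing_rv mu ->
  (forall (l s : 'I_(nblocks mu)) (a : 'I_#|block l|) (b : 'I_#|block s|), l != s ->
    A (enum_val a) (enum_val b) = 0) ->
  (forall (l : 'I_(nblocks mu)) (a b : 'I_#|block l|),
    A (enum_val a) (enum_val b) = V l a b) ->
  A = block_diag_mx V.
Proof.
move=> mu_dec A_off A_in; rewrite /block_diag_mx.
apply: (canRL (castmxKV _ _)); set B := castmx _ A.
have BE (l s : 'I_(nblocks mu)) (a : 'I_#|block l|) (b : 'I_#|block s|) :
    B (tagnat.Rank _ a) (tagnat.Rank _ b) = A (enum_val a) (enum_val b).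
  by rewrite /B castmxE !esymK -!cast_Rank.
rewrite -(submxblockK B) /mxdiag; apply/eq_mxblockP => l s.
apply/matrixP => a b; rewrite mxE BE; case: eqVneq => [ls|ls].
  (* The [conform_mx] hidden in [\mxdiag] is the identity once [s] is replaced by [l]. *)
  by case: _ / ls in b *; rewrite conform_mx_id A_in.
by rewrite mxE A_off.
Qed.

End blocks.

(** * Limits of the eigenvalues and eigenvectors *)

Section perturbation.
Context {R : realType} {n : nat} (mu : 'rV[R]_n).
Context (M_ : nat -> 'M[R]_n) (M : 'M[R]_n) (U_ : nat -> 'M[R]_n) (U : 'M[R]_n).
Hypothesis mu_noninc : nonincreasing_rv mu.
Hypothesis M_sym : forall m : nat, M_ m \is symmetricmx.
Hypothesis M_neq0 : forall m : nat, M_ m != 0.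
Hypothesis M_cvg0 : M_ @ \oo --> (0 : 'M[R]_n).
Hypothesis M_dir : (fun m => (frobenius (M_ m))^-1 *: M_ m) @ \oo --> M.
Hypothesis U_orth : forall m : nat, orthogonalmx (U_ m).
Hypothesis U_lim_orth : orthogonalmx U.
Hypothesis U_cvg : U_ @ \oo --> U.
Hypothesis U_diag : forall m : nat,
  diag_mx mu + M_ m
    = U_ m *m diag_mx (lambda (diag_mx mu + M_ m)) *m (U_ m)^T.

Let nu m := frobenius (M_ m).
Let ev m := lambda (diag_mx mu + M_ m).

Lemma nu_neq0 m : nu m != 0.
Proof. by rewrite /nu frobenius_eq0. Qed.

Lemma M_coord i j : (M_ m i j / nu m) @[m --> \oo] --> M i j.
Proof.
have := cvg_coord M_dir (i := i) (j := j).
by under eq_fun do rewrite mxE mulrC.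
Qed.

Lemma U_coord i j : U_ m i j @[m --> \oo] --> U i j.
Proof. exact: cvg_coord. Qed.

Lemma symmetric_coord (A : 'M[R]_n) i j : A \is symmetricmx -> A i j = A j i.
Proof.
by move=> /is_hermitianmxP/matrixP/(_ i j); rewrite !mxE expr0 mul1r.
Qed.

Lemma M_symm i j : M i j = M j i.
Proof.
have := @M_coord j i; under eq_fun do rewrite (symmetric_coord _ _ (M_sym _)).
exact: norm_cvg_unique (@M_coord i j).
Qed.

Lemma ev_noninc m : nonincreasing_rv (ev m).
Proof.
suff /lambdaP[] : diag_mx mu + M_ m \is symmetricmx by [].
apply/is_hermitianmxP/matrixP => i j.
rewrite expr0 scale1r !mxE /= (symmetric_coord _ _ (M_sym m)) eq_sym.
by case: eqVneq => // ->.
Qed.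

Lemma ev_conj m : diag_mx (ev m) = (U_ m)^T *m (diag_mx mu + M_ m) *m U_ m.
Proof.
by rewrite U_diag !mulmxA U_orth mul1mx -mulmxA U_orth mulmx1.
Qed.

(** In the form [ev_conj] every factor converges, and the perturbation disappears in the limit. *)
Lemma ev_diag_cvg i j :
  diag_mx (ev m) i j @[m --> \oo] --> (U^T *m diag_mx mu *m U) i j.
Proof.
under eq_fun do rewrite ev_conj.
apply: cvg_mulmx_coord; last exact: U_coord.
apply: cvg_mulmx_coord => k l.
  by rewrite mxE; under eq_fun do rewrite mxE; exact: U_coord.
rewrite -(addr0 (diag_mx mu k l)); under eq_fun do rewrite mxE.
apply: cvgD; first exact: cvg_cst.
by have := cvg_coord M_cvg0 (i := k) (j := l); rewrite mxE.
Qed.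

(* The limit is diagonal with nonincreasing diagonal, being a limit of such
   matrices, and orthogonally similar to [diag_mx mu]. *)
Lemma U_conj_mu : U^T *m diag_mx mu *m U = diag_mx mu.
Proof.
pose d := \row_i (U^T *m diag_mx mu *m U) i i.
have D_diag : U^T *m diag_mx mu *m U = diag_mx d.
  apply/matrixP => i j; rewrite [RHS]mxE.
  case: eqVneq => [->|ij]; first by rewrite [RHS]mxE.
  apply: (norm_cvg_unique (@ev_diag_cvg i j)) => /=.
  under eq_fun do rewrite mxE (negPf ij) mulr0n.
  exact: cvg_cst.
have d_dec : nonincreasing_rv d.
  move=> i j ij; rewrite mxE [leRHS]mxE.
  apply: (ler_cvg_to (@ev_diag_cvg j j) (@ev_diag_cvg i i)).
  by apply: nearW => m; rewrite !mxE !eqxx !mulr1n; exact: ev_noninc.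
(* Both [d] and [mu] equal [lambda (diag_mx mu)]; for [mu] the conjugating matrix is the
   identity. *)
rewrite D_diag -(lambda_diag_conj U_lim_orth d_dec D_diag); congr diag_mx.
apply: (@lambda_diag_conj _ _ 1%:M) => //.
  by rewrite /orthogonalmx trmx1 mul1mx.
by rewrite trmx1 mul1mx mulmx1.
Qed.

Lemma ev_cvg i : ev m 0 i @[m --> \oo] --> mu 0 i.
Proof.
have := @ev_diag_cvg i i; rewrite U_conj_mu mxE eqxx mulr1n.
by under eq_fun do rewrite mxE eqxx mulr1n.
Qed.

(** [U] commutes with [diag_mx mu], which entrywise reads (mu_i - mu_j) U_ij = 0. *)
Lemma U_off i j : mu 0 i != mu 0 j -> U i j = 0.
Proof.
move=> mu_ij; have comm : diag_mx mu *m U = U *m diag_mx mu.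
  by rewrite -{2}U_conj_mu !mulmxA orthogonalmx_trr// mul1mx.
have /matrixP/(_ i j) := comm; rewrite mul_diag_mx mul_mx_diag !mxE => /eqP.
rewrite [U i j * _]mulrC -subr_eq0 -mulrBl mulf_eq0 subr_eq0 (negPf mu_ij).
by move/eqP.
Qed.

(** * First-order rates of off-block entries and of block sums *)

Lemma MU_cvg i j : ((M_ m *m U_ m) i j / nu m) @[m --> \oo] --> (M *m U) i j.
Proof.
have -> : (fun m => (M_ m *m U_ m) i j / nu m) =
    (fun m => ((nu m)^-1 *: M_ m *m U_ m) i j).
  by apply/funext => m; rewrite -scalemxAl [RHS]mxE mulrC.
apply: cvg_mulmx_coord; last exact: U_coord.
by move=> k l; exact: (cvg_coord M_dir).
Qed.

(* From the entries [(mu_i - lambda_j) U_m^(ij) = - (M_m U_m)^(ij)] of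
   [(diag mu + M_m) U_m = U_m diag lambda]. *)
Lemma U_rate i j : mu 0 i != mu 0 j ->
  (U_ m i j / nu m) @[m --> \oo] --> (M *m U) i j / (mu 0 j - mu 0 i).
Proof.
move=> mu_ij; have ji_neq0 : mu 0 j - mu 0 i != 0 by rewrite subr_eq0 eq_sym.
have ent m : U_ m i j * (ev m 0 j - mu 0 i) = (M_ m *m U_ m) i j.
  have /(congr1 (mulmx^~ (U_ m))) := U_diag m.
  rewrite -mulmxA U_orth mulmx1 mulmxDl => /matrixP/(_ i j).
  rewrite mul_diag_mx mul_mx_diag [LHS]mxE [X in X + _]mxE [RHS]mxE -/(ev m) => h.
  by rewrite mulrBr -h [U_ m i j * _]mulrC [LHS]addrC addKr.
have ev_cvg' : (ev m 0 j - mu 0 i) @[m --> \oo] --> mu 0 j - mu 0 i.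
  by apply: cvgB; [exact: ev_cvg|exact: cvg_cst].
have lim : ((M_ m *m U_ m) i j / nu m / (ev m 0 j - mu 0 i)) @[m --> \oo]
    --> (M *m U) i j / (mu 0 j - mu 0 i).
  by apply: cvgM; [exact: MU_cvg|exact: cvgV].
(* The denominator may vanish for small [m], so the identity is only eventual. *)
apply: cvg_trans lim; apply: near_eq_cvg.
near=> m; have evm : ev m 0 j - mu 0 i != 0.
  by near: m; exact: cvgr_neq0 ev_cvg' ji_neq0.
by rewrite -ent mulrAC mulfK.
Unshelve. all: by end_near.
Qed.

(** As [j] lies outside block [t], each [U_ m j p] has the rate given by [U_rate] while [U_ m i p]
    converges, so the limit can be taken term by term. *)
Lemma off_sum_cvg (l s t : 'I_(nblocks mu)) i j :
  i \in block l -> j \in block s -> s != t ->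
  ((\sum_(p in block t) U_ m i p * U_ m j p) / nu m) @[m --> \oo] -->
    ((l == t)%:R / (mu 0 i - mu 0 j) * M i j).
Proof.
move=> il js st.
have jt p : p \in block t -> mu 0 j != mu 0 p.
  by move=> pt; rewrite eq_sym -(block_mu j pt) (block_inj t js).
suff <- : \sum_(p in block t) U i p * ((M *m U) j p / (mu 0 p - mu 0 j)) =
    (l == t)%:R / (mu 0 i - mu 0 j) * M i j.
  under eq_fun do rewrite mulr_suml.
  apply: cvg_sumr => p pt; under eq_fun do rewrite -mulrA.
  by apply: cvgM; [exact: U_coord|exact: U_rate (jt _ pt)].
case: eqVneq => [lt|lt]; last first.
  rewrite !mul0r big1// => p pt; rewrite U_off ?mul0r//.
  by rewrite eq_sym -(block_mu i pt) (block_inj t il).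
rewrite -lt in jt *.
(* On block [l] the denominator mu_p - mu_j equals mu_i - mu_j, and off it U_ip = 0; extending the
   sum to all [p] produces an entry of M U U^T = M. *)
transitivity ((mu 0 i - mu 0 j)^-1 * \sum_p (M *m U) j p * U^T p i).
  rewrite [in RHS](bigID (mem (block l)))/= [X in _ * (_ + X)]big1 => [|p]; last first.
    by rewrite (block_mu p il) => ip; rewrite [U^T p i]mxE (U_off ip) mulr0.
  rewrite addr0 big_distrr; apply: eq_bigr => p pt /=; rewrite [U^T p i]mxE.
  by move: pt; rewrite (block_mu p il) => /eqP ->; rewrite mulrC -mulrA mulrCA.
have -> : \sum_p (M *m U) j p * U^T p i = M j i.
  by rewrite -[in RHS](mulmx1 M) -(orthogonalmx_trr U_lim_orth) mulmxA [RHS]mxE.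
by rewrite mul1r M_symm.
Qed.

Lemma block_sum_cvg (l s t : 'I_(nblocks mu)) i j :
  i \in block l -> j \in block s ->
  ((\sum_(p in block t) U_ m i p * U_ m j p - (i == j)%:R * (l == t)%:R) / nu m)
    @[m --> \oo] -->
    (((l == t)%:R - (s == t)%:R) / (mu 0 i - mu 0 j) * M i j).
Proof.
move=> il js; have [st|st] := boolP (s != t).
  have := off_sum_cvg il js st; rewrite (negPf st) subr0.
  have -> : (i == j)%:R * (l == t)%:R = 0 :> R.
    case: eqVneq => [ij|_]; rewrite ?mul0r// mul1r.
    by move: js; rewrite -ij (block_inj s il) => /eqP ->; rewrite (negPf st).
  by under [in X in _ -> X]eq_fun do rewrite subr0.
have {st} st : s = t by apply/eqP; rewrite negbK in st.
rewrite {}st eqxx in js *; have [lt|lt] := boolP (l != t).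
  (* Exchanging [i] and [j] negates both numerator and denominator of the fraction. *)
  have := off_sum_cvg js il lt; rewrite eqxx (negPf lt) sub0r mulr0.
  rewrite -(opprB (mu 0 j)) invrN mulrNN M_symm.
  under [in X in _ -> X]eq_fun do rewrite subr0.
  by under eq_fun do under eq_bigr do rewrite mulrC.
have {lt} lt : l = t by apply/eqP; rewrite negbK in lt.
rewrite {}lt eqxx subrr !mul0r mulr1 in il *.
(* All three blocks coincide: orthonormality of the rows of [U_ m] trades the sum over [t] for minus
   the sum over its complement, where [U_ m i p] tends to 0 and [U_ m j p / nu m] converges. *)
have -> : (fun m => (\sum_(p in block t) U_ m i p * U_ m j p - (i == j)%:R) / nu m)
    = (fun m => - \sum_(p | p \notin block t) U_ m i p * (U_ m j p / nu m)).
  apply/funext => m; have := orthogonalmx_trr (U_orth m).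
  move/matrixP/(_ i j); rewrite [LHS]mxE [RHS]mxE.
  under eq_bigr do rewrite [(U_ m)^T _ _]mxE.
  rewrite (bigID (mem (block t)))/= => <-.
  rewrite opprD addNKr mulNr mulr_suml; congr (- _).
  by apply: eq_bigr => p _; rewrite mulrA.
have /cvgN : (\sum_(p | p \notin block t) U_ m i p * (U_ m j p / nu m))
    @[m --> \oo] -->
    \sum_(p | p \notin block t) U i p * ((M *m U) j p / (mu 0 p - mu 0 j)).
  apply: cvg_sumr => p; rewrite (block_mu p js) => jp.
  by apply: cvgM; [exact: U_coord|exact: U_rate].
rewrite big1 ?oppr0// => p.
by rewrite (block_mu p il) => /U_off ->; rewrite mul0r.
Qed.

(** * Within-block entries of the conjugated limit direction *)

(** Columns of [U_ m] are orthonormal, so subtracting mu_i on the diagonal replaces mu_p by mu_p -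
    mu_i in the part coming from [diag_mx mu]. Terms with mu_p = mu_i then vanish; in the others
    [U_ m p i] tends to 0 while [U_ m p j / nu m] converges. Only the part coming from [M]
    survives. *)
Lemma conj_coord_cvg i j : mu 0 i = mu 0 j ->
  ((diag_mx (ev m) i j - (mu 0 i) *+ (i == j)) / nu m) @[m --> \oo] -->
    (U^T *m M *m U) i j.
Proof.
move=> mu_ij.
have -> : (fun m => (diag_mx (ev m) i j - (mu 0 i) *+ (i == j)) / nu m) =
    (fun m => \sum_p (mu 0 p - mu 0 i) * (U_ m p i * (U_ m p j / nu m))
      + ((U_ m)^T *m ((nu m)^-1 *: M_ m) *m U_ m) i j).
  apply/funext => m; rewrite ev_conj mulmxDr mulmxDl [in LHS]mxE.
  have -> : mu 0 i *+ (i == j) = \sum_p mu 0 i * (U_ m p i * U_ m p j).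
    have /matrixP/(_ i j) := U_orth m; rewrite !mxE => h.
    rewrite -mulr_sumr -mulr_natr -h; congr (_ * _).
    by apply: eq_bigr => p _; rewrite mxE.
  rewrite addrAC mulrDl; congr (_ + _); last first.
    by rewrite -scalemxAr -scalemxAl [RHS]mxE mulrC.
  rewrite mul_mx_diag mxE -sumrB mulr_suml; apply: eq_bigr => p _.
  by rewrite !mxE; ring.
have conj_cvg : ((U_ m)^T *m ((nu m)^-1 *: M_ m) *m U_ m) i j @[m --> \oo]
    --> (U^T *m M *m U) i j.
  apply: cvg_mulmx_coord; last exact: U_coord.
  apply: cvg_mulmx_coord => k l; last exact: (cvg_coord M_dir).
  by rewrite mxE; under eq_fun do rewrite mxE; exact: U_coord.
have /cvgD/(_ conj_cvg) : (\sum_p (mu 0 p - mu 0 i) *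
      (U_ m p i * (U_ m p j / nu m))) @[m --> \oo] --> \sum_(p < n) (0 : R).
  apply: cvg_sumr => p _; case: (eqVneq (mu 0 p) (mu 0 i)) => [->|pi].
    by under eq_fun do rewrite subrr mul0r; exact: cvg_cst.
  have /(cvgM (cvg_cst (mu 0 p - mu 0 i))) :
      (U_ m p i * (U_ m p j / nu m)) @[m --> \oo] -->
      U p i * ((M *m U) p j / (mu 0 j - mu 0 p)).
    by apply: cvgM; [exact: U_coord|apply: U_rate; rewrite -mu_ij].
  by rewrite (U_off pi) mul0r mulr0.
by rewrite big1// add0r.
Qed.

(** The vector h of the statement, before its pieces are recognized as eigenvalues in
    [lambda_block]. *)
Let g := \row_i (U^T *m M *m U) i i.

Lemma conj_block_diag i j : mu 0 i = mu 0 j ->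
  (U^T *m M *m U) i j = g 0 i *+ (i == j).
Proof.
move=> mu_ij; case: eqVneq => [->|ij]; first by rewrite [RHS]mxE.
rewrite mulr0n; apply: (norm_cvg_unique (conj_coord_cvg mu_ij)) => /=.
under eq_fun do rewrite mxE (negPf ij) !mulr0n subr0 mul0r.
exact: cvg_cst.
Qed.

(** Both quotients subtract the same value of [mu] and divide by the same norm, so the order of the
    entries of [ev m] survives in the limit. *)
Lemma conj_block_noninc i j : mu 0 i = mu 0 j -> (i <= j)%N -> g 0 j <= g 0 i.
Proof.
move=> mu_ij ij; rewrite mxE [leRHS]mxE.
apply: (ler_cvg_to (@conj_coord_cvg j j erefl) (@conj_coord_cvg i i erefl)).
apply: nearW => m; rewrite !mxE !eqxx !mulr1n mu_ij.
rewrite ler_wpM2r// ?invr_ge0 ?sqrtr_ge0// lerD2r.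
exact: ev_noninc.
Qed.

(** Only p ~ i and q ~ j contribute to the entry (i, j), [U] being block-diagonal: within a block
    [mx_in] leaves these terms unchanged, across blocks it removes them all. *)
Lemma conj_mx_in : U^T *m mx_in mu M *m U = diag_mx g.
Proof.
have U_in p i : U p i != 0 -> mu 0 p = mu 0 i.
  by move=> Upi; apply/eqP; apply: contraNT Upi => /U_off ->.
have exp (A : 'M[R]_n) i j :
    (U^T *m A *m U) i j = \sum_q \sum_p U p i * A p q * U q j.
  rewrite mxE; apply: eq_bigr => q _; rewrite mxE mulr_suml.
  by apply: eq_bigr => p _; rewrite mxE.
apply/matrixP => i j; rewrite [RHS]mxE.
have [ij|ij] := eqVneq (mu 0 i) (mu 0 j); last first.
  have /negPf -> : i != j by apply: contraNneq ij => ->.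
  rewrite mulr0n exp.
  rewrite big1// => q _; rewrite big1// => p _; rewrite mxE.
  case: eqVneq => [pq|_]; last by rewrite mulr0 mul0r.
  have [->|/U_in pi] := eqVneq (U p i) 0; first by rewrite !mul0r.
  have [->|/U_in qj] := eqVneq (U q j) 0; first by rewrite mulr0.
  by case/eqP: ij; rewrite -pi pq qj.
rewrite -(conj_block_diag ij) !exp; apply: eq_bigr => q _; apply: eq_bigr => p _.
rewrite mxE; have [->|/U_in pi] := eqVneq (U p i) 0; first by rewrite !mul0r.
have [->|/U_in qj] := eqVneq (U q j) 0; first by rewrite !mulr0.
by rewrite pi qj ij eqxx.
Qed.

(** * Diagonal blocks of [U] and eigenvalues of the compressions of [M] *)

Let V (l : 'I_(nblocks mu)) := (block_basis l)^T *m U *m block_basis l.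

(** The span of the basis vectors of a block is invariant under [U], and [V l] is the matrix of the
    restriction. *)
Lemma basis_V (l : 'I_(nblocks mu)) :
  block_basis l *m V l = U *m block_basis l.
Proof.
apply/matrixP => i b; rewrite mulmx_block_basis.
have [il|il] := boolP (i \in block l); last first.
  rewrite U_off; last by rewrite eq_sym -(block_mu i (enum_valP b)).
  rewrite mxE big1// => a _; rewrite mxE; case: eqVneq => [ia|]; rewrite ?mul0r//.
  by case/negP: il; rewrite ia; exact: enum_valP.
rewrite -(enum_rankK_in il il); set a := enum_rank_in il i.
rewrite mxE (bigD1 a)//= [block_basis l _ _]mxE eqxx mul1r big1 ?addr0 => [|c ca].
  by rewrite mulmx_block_basis tr_block_basis_mulmx.
by rewrite [block_basis l _ _]mxE (inj_eq enum_val_inj) eq_sym (negPf ca) mul0r.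
Qed.

(** With X = [block_basis l], [basis_V] gives V^T V = X^T U^T U X = X^T X. *)
Lemma V_orth l : orthogonalmx (V l).
Proof.
rewrite /orthogonalmx {1}/V !trmx_mul trmxK -!mulmxA basis_V.
rewrite (mulmxA U^T) U_lim_orth mul1mx; apply/matrixP => a b.
by rewrite mulmx_block_basis !mxE (inj_eq enum_val_inj) eq_sym.
Qed.

Lemma U_block_diag : U = block_diag_mx V.
Proof.
apply: eq_block_diag_mx => // [l s a b ls|l a b]; last first.
  by rewrite mulmx_block_basis tr_block_basis_mulmx.
apply: U_off; rewrite -(block_mu _ (enum_valP a)).
by rewrite (block_inj l (enum_valP b)) eq_sym.
Qed.

(** By [basis_V], conjugating the compression of [M] by [V l] yields the corresponding block of U^T
    M U, which is diagonal with nonincreasing diagonal. *)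
Lemma lambda_block (l : 'I_(nblocks mu)) :
  lambda ((block_basis l)^T *m M *m block_basis l)
    = \row_(k < #|block l|) g 0 (enum_val k).
Proof.
have mu_eq (a b : 'I_#|block l|) : mu 0 (enum_val a) = mu 0 (enum_val b).
  by apply/eqP; rewrite -(block_mu _ (enum_valP a)) enum_valP.
apply: (lambda_diag_conj (V_orth l)) => [a b ab|].
  rewrite mxE [leRHS]mxE; apply: conj_block_noninc => //.
  move: ab; rewrite leq_eqVlt => /predU1P[/val_inj ->//|ab].
  exact/ltnW/enum_block_lt.
rewrite -!mulmxA basis_V 2!mulmxA -trmx_mul basis_V trmx_mul -!mulmxA.
apply/matrixP => a b; rewrite tr_block_basis_mulmx !mulmxA mulmx_block_basis.
by rewrite conj_block_diag// [RHS]mxE [in RHS]mxE (inj_eq enum_val_inj).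
Qed.

Lemma diag_mx_block_lambda :
  U^T *m mx_in mu M *m U
    = diag_mx (block_row (fun l : 'I_(nblocks mu) =>
        lambda ((block_basis l)^T *m M *m block_basis l))).
Proof.
rewrite conj_mx_in; congr diag_mx; apply/rowP => i.
have [l [k ->]] := block_enum_val mu i.
by rewrite block_rowE// lambda_block [RHS]mxE.
Qed.

End perturbation.

(* In the last clause the fraction vanishes when its numerator does, since
   [0 / x = 0] for every [x]. *)
Theorem theorem4p2 (R : realType) (n : nat) (mu : 'rV[R]_n)
    (M_ : nat -> 'M[R]_n) (M : 'M[R]_n) (U_ : nat -> 'M[R]_n) (U : 'M[R]_n)
    (mu_noninc : nonincreasing_rv mu)
    (M_sym : forall m : nat, M_ m \is symmetricmx)
    (M_neq0 : forall m : nat, M_ m != 0)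
    (M_cvg0 : M_ @ \oo --> (0 : 'M[R]_n))
    (M_dir : (fun m => (frobenius (M_ m))^-1 *: M_ m) @ \oo --> M)
    (U_orth : forall m : nat, orthogonalmx (U_ m))
    (U_lim_orth : orthogonalmx U)
    (U_cvg : U_ @ \oo --> U)
    (U_diag : forall m : nat,
      diag_mx mu + M_ m
        = U_ m *m diag_mx (lambda (diag_mx mu + M_ m)) *m (U_ m)^T) :
  [/\ (exists V : forall l : 'I_(nblocks mu), 'M[R]_#|block l|,
        (forall l, orthogonalmx (V l)) /\ U = block_diag_mx V),
      U^T *m mx_in mu M *m U
        = diag_mx (block_row (fun l : 'I_(nblocks mu) =>
            lambda ((block_basis l)^T *m M *m block_basis l)))
    & forall (l s t : 'I_(nblocks mu)) (i j : 'I_n),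
        i \in block l -> j \in block s ->
        (fun m => \sum_(p in block t) U_ m i p * U_ m j p)
          = (fun m => (i == j)%:R * (l == t)%:R
               + ((l == t)%:R - (s == t)%:R) / (mu 0 i - mu 0 j)
                 * M i j * frobenius (M_ m))
          +o_\oo (fun m => frobenius (M_ m))].
Proof.
split.
- exists (fun l => (block_basis l)^T *m U *m block_basis l).
  by split=> [l|]; [exact: V_orth|exact: U_block_diag].
- exact: diag_mx_block_lambda.
- move=> l s t i j il js; apply: eqaddo_ratio => [m|].
    exact: nu_neq0.
  (* Subtracting the limit as a constant sequence leaves the remainder divided by the norm. *)
  have /cvgB/(_ (cvg_cst _)) := block_sum_cvg mu_noninc M_sym M_cvg0 M_dir
    U_orth U_lim_orth U_cvg U_diag (t := t) il js.
  move=> /(_ (((l == t)%:R - (s == t)%:R) / (mu 0 i - mu 0 j) * M i j)).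
  rewrite subrr; apply: cvg_trans.
  apply: near_eq_cvg; apply: nearW => m /=.
  by rewrite opprD addrA [RHS]mulrBl (mulfK (nu_neq0 M_neq0 m)).
Qed.
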